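(* Let $d\ge1$ and let $\mathcal{X}_n=\{X_1,\dots,X_n\}$ be i.i.d. samples in $\mathbb{R}^d$ from the standard Gaussian density $f_{\mathrm g}(x)=c_{\mathrm g}e^{-\|x\|^2/2}$. Let $\epsilon>0$ and let $$R_n=\sqrt{2\log n+(d-2+\epsilon)\log\log n}$$ (for $n$ large enough that this is defined). Let $\beta_{k,n}=\beta_k\big(\check{C}(\mathcal{X}_n\cap (B_{R_n}(0))^c,1)\big)$. Then for every $0\le k\le d-1$, $$\lim_{n\to\infty}\mathbb{E}\{\beta_{k,n}\}=0.$$
   Context: $\|\cdot\|$ is the Euclidean norm; $B_r(x)$ is the closed Euclidean ball of radius $r$ about $x$; $c_{\mathrm g}>0$ is the normalization constant making $f_{\mathrm g}$ a probability density. For a finite set $\mathcal{Y}\subset\mathbb{R}^d$ and $\varepsilon>0$, the Čech complex $\check{C}(\mathcal{Y},\varepsilon)$ is the abstract simplicial complex with vertex set $\mathcal{Y}$ in which $[x_{i_0},\dots,x_{i_m}]$ is a simplex iff $\bigcap_{j=0}^m B_\varepsilon(x_{i_j})\neq\emptyset$. $\beta_k$ denotes the $k$-th Betti number (rank of the $k$-th homology group). *)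

(* Defs.v *)
From HB Require Import structures.
From mathcomp Require Import all_boot all_order all_algebra finmap.
From mathcomp Require Import all_classical all_reals all_analysis.

Set Implicit Arguments.
Unset Strict Implicit.
Unset Printing Implicit Defensive.

Import Order.TTheory GRing.Theory Num.Theory.
Import numFieldNormedType.Exports.
Local Open Scope classical_set_scope.
Local Open Scope ring_scope.

(* R^d as d-tuples of reals: the library equips tuples with the product of
   the Borel sigma-algebras of the coordinates. *)
Notation Rd R d := (d.-tuple (measurableTypeR R)).

Section Euclidean.
Context {R : realType} {d : nat}.

Definition enorm (x : Rd R d) : R :=
  Num.sqrt (\sum_(i < d) (tnth x i : R) ^+ 2).

Definition esub (x y : Rd R d) : Rd R d :=
  [tuple (tnth x i : R) - (tnth y i : R) | i < d].

Definition eorigin : Rd R d := [tuple (0 : R) | _ < d].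

Definition closed_eball (r : R) (x : Rd R d) : set (Rd R d) :=
  [set y | enorm (esub y x) <= r].

End Euclidean.

Section LebesgueRd.
Context {R : realType}.

Definition cons_point n (p : Rd R n * measurableTypeR R) : Rd R n.+1 :=
  [tuple of p.2 :: p.1].

Lemma measurable_cons_point n : measurable_fun [set: _] (@cons_point n).
Proof. by apply: measurable_cons. Qed.

Definition lebesgue_cons n (mu : {measure set (Rd R n) -> \bar R}) :=
  pushforward (mu \x (@lebesgue_measure R))%E (@cons_point n).

HB.instance Definition _ n (mu : {measure set (Rd R n) -> \bar R}) :=
  Measure.copy (lebesgue_cons mu)
    (measure_function_pushforward__canonical__measure_function_Measure
       (mu \x (@lebesgue_measure R))%E (@measurable_cons_point n)).

(* Lebesgue measure on R^n, as the n-fold product of the Lebesgue measure on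
   the line; R^0 is a point, of mass 1. *)
Fixpoint lebesgue_Rd n : {measure set (Rd R n) -> \bar R} :=
  match n return {measure set (Rd R n) -> \bar R} with
  | 0 => dirac eorigin
  | n'.+1 => lebesgue_cons (lebesgue_Rd n')
  end.

End LebesgueRd.

Section Homology.
Context {T : finType}.
Variable K : {set {set T}}.

(* Simplices are indexed by their number m of vertices, that is by their
   dimension plus one.  A simplex is nonempty, so there is none for m = 0: the
   chain group of degree -1 vanishes and the homology below is unreduced. *)
Definition simplex (m : nat) := {s : {set T} | (s \in K) && (#|s| == m)}.

Definition chain (m : nat) := {ffun simplex m -> int}.

(* Coefficient of the face t in the boundary of s, each simplex being oriented
   by the enumeration order of the vertices: (-1) ^ i when t is s without its
   i-th vertex (counted from 0), and 0 when t is not a facet of s. *)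
Definition incidence (s t : {set T}) : int :=
  \sum_(x in s | t == (s :\ x)%SET)
    (-1) ^+ #|[pred y in s | (enum_rank y < enum_rank x)%N]|.

Definition boundary (m : nat) (c : chain m.+1) : chain m :=
  [ffun t => \sum_(s : simplex m.+1) c s * incidence (val s) (val t)].

Definition cycle_pred (m : nat) : {pred chain m.+1} :=
  [pred c | boundary c == 0].

Lemma boundaryB m : {morph @boundary m : c c' / c - c'}.
Proof.
move=> c c'; apply/ffunP => t; rewrite !ffunE -sumrB.
by apply: eq_bigr => s _; rewrite !ffunE mulrBl.
Qed.

Lemma cycle_pred_zmod m : zmod_closed (@cycle_pred m).
Proof.
have b0 : @boundary m 0 = 0 by rewrite -(subr0 0) boundaryB subrr.
split=> [|c c']; rewrite !inE ?b0// => /eqP c0 /eqP c'0.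
by rewrite boundaryB c0 c'0 subrr.
Qed.

HB.instance Definition _ m := GRing.isZmodClosed.Build _ (@cycle_pred m)
  (@cycle_pred_zmod m).

Record cycle (m : nat) :=
  Cycle { cycle_val :> chain m.+1; _ : cycle_val \in @cycle_pred m }.

HB.instance Definition _ m := [isSub for @cycle_val m].
HB.instance Definition _ m := [Choice of cycle m by <:].
HB.instance Definition _ m := [SubChoice_isSubZmodule of cycle m by <:].

Definition boundary_pred (m : nat) : {pred cycle m} :=
  [pred z : cycle m | `[< exists c : chain m.+2, boundary c = val z >]].

Lemma boundary_pred_zmod m : zmod_closed (@boundary_pred m).
Proof.
split=> [|z z']; rewrite !inE.
  by exists 0; rewrite -(subr0 0) boundaryB subrr raddf0.
move=> [c cz] [c' cz']; exists (c - c').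
by rewrite boundaryB cz cz' raddfB.
Qed.

HB.instance Definition _ m := GRing.isZmodClosed.Build _ (@boundary_pred m)
  (@boundary_pred_zmod m).

(* k-th simplicial homology group with integer coefficients *)
Definition homology (k : nat) : zmodType := Quotient.quot (@boundary_pred k).

End Homology.

Definition Z_free (V : zmodType) (r : nat) (v : 'I_r -> V) :=
  forall a : 'I_r -> int, \sum_(i < r) v i *~ a i = 0 -> forall i, a i = 0.

Definition free_sizes (V : zmodType) : set nat :=
  [set r | exists v : 'I_r -> V, Z_free v].

(* Rank of an abelian group: the largest size of a Z-linearly independent
   family (0 by convention when these sizes are unbounded, which does not
   happen for finitely generated groups). *)
Definition abelian_rank (V : zmodType) : nat :=
  xget 0%N [set r | free_sizes V r /\ ubound (free_sizes V) r].

Definition betti (T : finType) (k : nat) (K : {set {set T}}) : nat :=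
  abelian_rank (homology K k).

Section Cech.
Context {R : realType} {d : nat}.

Definition cech (Y : {fset Rd R d}) (eps : R) : {set {set Y}} :=
  [set s : {set Y} | (0 < #|s|)%N &&
    `[< \bigcap_(x in [set` s]) closed_eball eps (val x) !=set0 >]]%SET.

End Cech.

Section Probability.
Context {R : realType} {dO : measure_display} {Omega : measurableType dO}.
Variable P : probability Omega R.

Definition mutually_independent d' (E : measurableType d')
    (X : nat -> {RV P >-> E}) :=
  forall (J : {fset nat}) (A : nat -> set E),
    (forall i, i \in J -> measurable (A i)) ->
    P (\bigcap_(i in [set` J]) (X i @^-1` A i)) =
    (\prod_(i <- J) P (X i @^-1` A i))%E.

Definition has_density d (X : {RV P >-> Rd R d}) (f : Rd R d -> R) :=
  forall A : set (Rd R d), measurable A ->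
    distribution P X A = (\int[lebesgue_Rd d]_(x in A) (f x)%:E)%E.

End Probability.

Section Gaussian.
Context {R : realType} {d : nat}.

Definition gauss_exp (x : Rd R d) : R := expR (- (enorm x ^+ 2 / 2)).

Definition c_gauss : R :=
  (fine (\int[lebesgue_Rd d]_x (gauss_exp x)%:E))^-1.

Definition gauss_density (x : Rd R d) : R := c_gauss * gauss_exp x.

End Gaussian.

(* ln and Num.sqrt are total (0 on negative arguments); for a fixed d and
   eps > 0 the formula has its usual meaning for all large n. *)
Definition outlier_radius {R : realType} (d : nat) (eps : R) (n : nat) : R :=
  Num.sqrt (2 * ln n%:R + (d%:R - 2 + eps) * ln (ln n%:R)).

Section Statistic.
Context {R : realType} {d : nat}.

(* the sample consists of the first n terms of x *)
Definition sample (x : nat -> Rd R d) (n : nat) : {fset Rd R d} :=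
  [fset x (nat_of_ord i) | i : 'I_n]%fset.

Definition outside_ball (Y : {fset Rd R d}) (r : R) : {fset Rd R d} :=
  [fset y in Y | y \in ~` closed_eball r eorigin]%fset.

End Statistic.

(* Main.v *)
Require Import Defs.
From HB Require Import structures.
From mathcomp Require Import all_boot all_order all_algebra finmap.
From mathcomp Require Import all_classical all_reals all_analysis.
From mathcomp Require Import measurable_realfun ring lra.

Set Implicit Arguments.
Unset Strict Implicit.
Unset Printing Implicit Defensive.

Import Order.TTheory GRing.Theory Num.Theory.
Import numFieldNormedType.Exports.
Local Open Scope classical_set_scope.
Local Open Scope ring_scope.

(** The radius is chosen so that a sample point rarely falls outside the ball
    at all: if p_n is the probability that it does, then n p_n tends to 0.
    The k-th homology group is a subquotient of the group of k-chains,
    so the k-th Betti number is at most the number of k-simplices, hence at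
    most the number of (k+1)-subsets of the N points outside the ball.  By
    independence the expected number of such subsets is
    C(n, k+1) p_n^(k+1) <= (n p_n)^(k+1), which tends to 0
    ([betti_le_card_simplex], [expectation_betti_outside_le]).

    The work is in the tail p_n: its power of the radius has to be sharp,
    since eps is arbitrary and any loss of a power of log n would be fatal.
    What is needed is that the integral of exp(-|x|^2/2) over |x|^2 > t is
    O((1+t)^((d-2)/2) exp(-t/2)).  Polar coordinates are avoided by
    integrating the coordinates out one at a time.  If h is a function of
    |x|^2 on R^(d+1), integrating the last coordinate produces the function
    u |-> int h(u + x^2) dx of |x|^2 on R^d; so it suffices to exhibit a
    sequence h_0, h_1, ... ([radial_bound]) whose first term is
    exp(-u/2) 1(u > t), such that integrating out a coordinate sends h_j below
    h_(j+1) ([integral_radial_bound_le]), and to evaluate h_d at 0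
    ([integral_sumsq_radial_bound_le], [gauss_tail_le]).

    With L = log n, the value t = R_n^2 = 2 L + (d-2+eps) log L turns
    n exp(-t/2) into L^(-(d-2+eps)/2), while t is comparable to L; hence
    n p_n = O(L^(-eps/2)) ([natr_radial_bound_le]). *)

(** * Betti numbers and numbers of simplices *)

(** The Smith normal form L D Q of M has a zero last row in D as soon as M has
    more rows than columns, so the last row of L^-1 is an integer relation. *)
Lemma int_rows_dependent (r N : nat) (M : 'M[int]_(r, N)) : (N < r)%N ->
  exists2 a : 'rV[int]_r, a != 0 & a *m M = 0.
Proof.
case: r M => // r M Nr.
have [L Lu [Q _ [s _ ->]]] := int_Smith_normal_form M.
have aL : row ord_max (invmx L) *m L = row ord_max 1%:M.
  by rewrite -row_mul mulVmx.
exists (row ord_max (invmx L)).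
  apply/eqP => a0; move: aL; rewrite a0 mul0mx => /rowP/(_ ord_max).
  by rewrite !mxE eqxx.
rewrite !mulmxA aL -row_mul mul1mx [X in X *m _](_ : _ = 0) ?mul0mx//.
apply/rowP => j; rewrite !mxE.
suff /negbTE-> : (ord_max : 'I_r.+1) != j :> nat by rewrite mulr0n.
by rewrite neq_ltn (leq_trans (ltn_ord j))// orbT.
Qed.

Lemma abelian_rank_le (V : zmodType) (N : nat) :
  (forall r, free_sizes V r -> (r <= N)%N) -> (abelian_rank V <= N)%N.
Proof. by move=> VN; rewrite /abelian_rank; case: xgetP => // r _ [/VN]. Qed.

(** Representing cycles of more classes than there are simplices satisfy a
    nontrivial integer relation as chains, which the classes inherit. *)
Lemma betti_le_card_simplex (T : finType) (k : nat) (K : {set {set T}}) :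
  (betti k K <= #|{: simplex K k.+1}|)%N.
Proof.
apply: abelian_rank_le => r [v vfree]; rewrite leqNgt; apply/negP => ltr.
pose M : 'M[int]_(r, #|{: simplex K k.+1}|) :=
  \matrix_(i, j) val (repr (v i)) (enum_val j).
have [a a0 aM] := int_rows_dependent M ltr.
have z0 : \sum_(i < r) repr (v i) *~ a 0 i = 0.
  apply: val_inj; rewrite raddf_sum raddf0; apply/ffunP => s.
  rewrite sum_ffunE [RHS]ffunE.
  transitivity ((a *m M) 0 (enum_rank s)); last by rewrite aM mxE.
  rewrite mxE; apply: eq_bigr => i _.
  by rewrite [RHS]mulrC mxE enum_rankK raddfMz ffunMzE mulrzz.
have az i : a 0 i = 0.
  apply: (vfree (fun i => a 0 i)) i.
  transitivity (\pi_(homology K k)%qT (\sum_(i < r) repr (v i) *~ a 0 i)).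
    rewrite raddf_sum; apply: eq_bigr => i _.
    by rewrite raddfMz /= reprK.
  by rewrite z0 raddf0.
by move/eqP: a0; apply; apply/rowP => i; rewrite az mxE.
Qed.

Lemma betti_le_bin (T : finType) (k : nat) (K : {set {set T}}) :
  (betti k K <= 'C(#|T|, k.+1))%N.
Proof.
apply: leq_trans (betti_le_card_simplex k K) _.
rewrite card_sig -card_draws; apply: subset_leq_card.
by apply/fintype.subsetP => s; rewrite !inE => /andP[].
Qed.

(** An inequality only, because sample points may coincide. *)
Lemma card_outside_ball_le (R : realType) (d n : nat) (x : nat -> Rd R d)
    (r : R) :
  (#|` outside_ball (sample x n) r|
    <= #|[set i : 'I_n | x i \in ~` closed_eball r eorigin]%SET|)%N.
Proof.
set S := [set i : 'I_n | _]%SET.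
pose Z := [fset x (nat_of_ord i) | i in S]%fset.
apply: (@leq_trans #|` Z|); last first.
  by apply: leq_trans (leq_imfset_card _ _ _) _; rewrite -cardE.
apply: fsubset_leq_card; apply/fsubsetP => y.
rewrite !inE /= => /andP[/imfsetP[i _ ->] xi].
by apply/imfsetP; exists i; rewrite //= inE.
Qed.

(** Subsets of indices replace subsets of points, so that the expectation of
    the right-hand side is a sum of probabilities of joint events. *)
Lemma betti_outside_le (R : realType) (d n k : nat) (x : nat -> Rd R d)
    (r : R) :
  (betti k (cech (outside_ball (sample x n) r) 1) <=
   \sum_(J : {set 'I_n} | #|J| == k.+1)
     [forall i in J, x i \in ~` closed_eball r eorigin])%N.
Proof.
apply: leq_trans (betti_le_bin _ _) _.
rewrite -cardfE.
apply: leq_trans (leq_bin2l _ (card_outside_ball_le _ _ _)) _.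
rewrite -cards_draws -sum1dep_card big_mkcondl big_mkcond [leqRHS]big_mkcond /=.
apply: leq_sum => J _; case: ifP => // _; case: ifP => // /fintype.subsetP JS.
by rewrite lt0b; apply/forall_inP => i /JS; rewrite inE.
Qed.

(** * The expected Betti number outside a ball *)

Lemma bin_le_expn (n m : nat) : ('C(n, m) <= n ^ m)%N.
Proof.
apply: (@leq_trans (n ^_ m)); first by rewrite -bin_ffact leq_pmulr ?fact_gt0.
elim: m n => [|m IHm] n; first by rewrite ffactn0.
rewrite ffactnS expnS leq_mul2l (leq_trans (IHm _)) ?orbT//.
by case: m {IHm} => // m; rewrite leq_exp2r ?leq_pred.
Qed.

(** The integral of a nonnegative function is a supremum over the simple
    functions below it, hence monotone without any measurability.  Only the
    bound on the Betti number then has to be a random variable. *)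
Lemma ge0_le_integral_setT d (T : measurableType d) (R : realType)
    (mu : {measure set T -> \bar R}) (f g : T -> \bar R) :
  (forall x, 0 <= f x)%E -> (forall x, f x <= g x)%E ->
  (\int[mu]_x f x <= \int[mu]_x g x)%E.
Proof.
move=> f0 fg; have g0 x : (0 <= g x)%E by exact: le_trans (f0 x) (fg x).
rewrite !ge0_integralTE//; apply: le_ereal_sup => _ [h hf <-].
by exists h => // x; exact: le_trans (hf x) (fg x).
Qed.

Section expectation_bound.
Context {R : realType} {dO : measure_display} {Omega : measurableType dO}.
Variable P : probability Omega R.

Lemma prob_all_in (d' : measure_display) (E : measurableType d')
    (X : nat -> {RV P >-> E}) (A : set E) (p : R) (n : nat) (J : {set 'I_n}) :
  mutually_independent X -> measurable A ->
  (forall i, P (X i @^-1` A) = p%:E) ->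
  P [set w | [forall i in J, X i w \in A]] = (p ^+ #|J|)%:E.
Proof.
move=> indep mA PA.
pose J' := [fset nat_of_ord i | i in J]%fset.
have -> : [set w | [forall i in J, X i w \in A]] =
    \bigcap_(i in [set` J']) (X i @^-1` A).
  apply/seteqP; split => w /=.
    move=> /forall_inP wJ _ /= /imfsetP[i /= iJ ->]; exact/set_mem/wJ.
  move=> wJ; apply/forall_inP => i iJ; apply/mem_set.
  by apply: (wJ i); apply/imfsetP; exists i.
rewrite indep//; under eq_bigr do rewrite PA.
rewrite prodEFin big_const_seq count_predT iter_mulr mulr1 card_imfset /=.
  by rewrite -cardE.
exact: val_inj.
Qed.

(** The right-hand side bounds the mean number of (k+1)-subsets of the sample
    that lie entirely outside the ball. *)
Lemma expectation_betti_outside_le (d : nat) (X : nat -> {RV P >-> Rd R d})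
    (r p : R) (k n : nat) :
  mutually_independent X ->
  measurable (~` closed_eball r eorigin : set (Rd R d)) ->
  (forall i, P (X i @^-1` (~` closed_eball r eorigin)) = p%:E) ->
  ('E_P[fun w =>
       (betti k (cech (outside_ball (sample (fun i => X i w) n) r) 1))%:R]
    <= ((n%:R * p) ^+ k.+1)%:E)%E.
Proof.
set A := (X in measurable X) => indep mA PA.
pose B (J : {set 'I_n}) := [set w | [forall i in J, X i w \in A]].
have mB J : measurable (B J).
  have -> : B J = \big[setI/setT]_(i in J) (X i @^-1` A).
    apply/seteqP; split => w /=.
      move=> /forall_inP wJ; rewrite -bigcap_seq_cond => i /= iJ.
      by apply/set_mem/wJ; move: iJ => /andP[].
    rewrite -bigcap_seq_cond => wJ; apply/forall_inP => i iJ; apply/mem_set.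
    by apply: wJ => /=; rewrite mem_index_enum iJ.
  apply: bigsetI_measurable => i _; rewrite -[X in measurable X]setTI.
  exact: measurable_funP.
have p0 : 0 <= p by rewrite -lee_fin -(PA 0%N).
rewrite unlock.
apply: (@le_trans _ _ (\int[P]_w
    (\sum_(J : {set 'I_n} | #|J| == k.+1) (\1_(B J) w)%:E))%E).
  apply: ge0_le_integral_setT => w; rewrite ?lee_fin// sumEFin lee_fin.
  apply: (@le_trans _ _ (\sum_(J : {set 'I_n} | #|J| == k.+1)
     [forall i in J, X i w \in A] : nat)%N%:R).
    by rewrite ler_nat; exact: (betti_outside_le n k (fun i => X i w) r).
  rewrite natr_sum; apply: ler_sum => J _; rewrite indicE.
  rewrite (_ : (w \in B J) = [forall i in J, X i w \in A])//.
  by apply/idP/idP => [/set_mem|/mem_set].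
under eq_integral do rewrite -big_filter.
rewrite ge0_integral_sum//; last first.
  by move=> J; exact/measurable_EFinP/measurable_indic.
rewrite big_filter.
rewrite (eq_bigr (fun _ => (p ^+ k.+1)%:E)); last first.
  move=> J /eqP Jk; rewrite integral_indic// setIT -Jk.
  exact: prob_all_in.
rewrite sumEFin lee_fin big_const iter_addr_0 -[leLHS]mulr_natl exprMn.
rewrite ler_wpM2r//.
  exact: exprn_ge0.
rewrite -natrX ler_nat; apply: leq_trans (bin_le_expn _ _).
rewrite -[X in 'C(X, _)]card_ord -card_draws.
by apply/eq_leq/eq_card => J; rewrite !inE.
Qed.

End expectation_bound.

(** * Integrals over one coordinate *)

Definition half_gauss {R : realType} (x : R) : R := expR (- (x ^+ 2 / 2)).

Section one_coordinate.
Context {R : realType}.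
Implicit Types (a c m x u t : R).
Local Notation mu := (@lebesgue_measure R).

(* The derivative of the primitive dominates half_gauss because
   2 (x^2 + x + 1) >= (1 + x)^2; unlike the usual -exp(-x^2/2)/x, the bound so
   obtained is uniform down to a = 0. *)
Let primitive x : R := - (2 * half_gauss x / (1 + x)).
Let integrand x : R := 2 * half_gauss x * (x ^+ 2 + x + 1) / (1 + x) ^+ 2.

Let is_derive_primitive x : 0 <= x -> is_derive x 1 primitive (integrand x).
Proof.
move=> x0; have x1 : 1 + x != 0 by rewrite gt_eqF// ltr_wpDr.
rewrite /primitive.
have dV : is_derive x 1 (fun y : R => (1 + y)^-1) (- (1 + x) ^- 2 *: 1).
  apply: is_deriveV => //.
  by apply: is_derive_eq; rewrite add0r.
apply: is_derive_eq.
by rewrite /integrand /half_gauss /GRing.scale /=; field.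
Qed.

Let continuous_half_gauss : continuous (@half_gauss R).
Proof.
move=> x; apply: continuous_comp; last exact: continuous_expR.
by apply: cvgN; apply: cvgM; [exact: exprn_continuous|exact: cvg_cst].
Qed.

Let cvg_primitive : primitive x @[x --> +oo] --> (0 : R).
Proof.
have g0 : half_gauss x @[x --> +oo] --> (0 : R).
  apply: (@cvg_comp _ _ _ (fun x : R => x ^+ 2 / 2) (fun y => expR (- y)) _
    (pinfty_nbhs R));
    last exact: cvgr_expR.
  apply: (@gt0_cvgMly _ _ _ 2^-1 (fun x => x ^+ 2)); first by rewrite invr_gt0.
  exact: cvgr_expr2.
apply: (@squeeze_cvgr _ _ _ _ (fun x => - (2 * half_gauss x)) (fun=> 0)).
- near=> x; have x0 : 0 <= x by near: x; exact: nbhs_pinfty_ge.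
  rewrite oppr_le0 lerN2 divr_ge0 ?mulr_ge0 ?addr_ge0 ?expR_ge0// andbT.
  by rewrite ler_pdivrMr ?ltr_wpDr// ler_peMr ?mulr_ge0 ?expR_ge0// lerDl.
- by rewrite -oppr0 -(mulr0 2); apply: cvgN;
    apply: cvgM; [exact: cvg_cst|exact: g0].
- exact: cvg_cst.
Unshelve. all: by end_near. Qed.

Lemma integral_gauss_tail_le a : 0 <= a ->
  (\int[mu]_(x in `[a, +oo[) (half_gauss x)%:E <=
    (2 * half_gauss a / (1 + a))%:E)%E.
Proof.
move=> a0.
have dF x : a <= x -> is_derive x 1 primitive (integrand x).
  by move=> /(le_trans a0); exact: is_derive_primitive.
have cF x : a <= x -> {for x, continuous integrand}.
  move=> /(le_trans a0) x0; rewrite /integrand.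
  apply: cvgM.
    apply: cvgM.
      by apply: cvgM; [exact: cvg_cst|exact: continuous_half_gauss].
    apply: cvgD; last exact: cvg_cst.
    by apply: cvgD; [exact: exprn_continuous|exact: cvg_id].
  apply: cvgV; first by rewrite expf_neq0// gt_eqF// ltr_wpDr.
  apply: (@cvg_comp _ _ _ (fun y : R => 1 + y) (fun y => y ^+ 2) _
    (nbhs (1 + x))); last exact: exprn_continuous.
  by apply: cvgD; [exact: cvg_cst|exact: cvg_id].
have wF : {within `[a, +oo[, continuous integrand}.
  apply: continuous_in_subspaceT => x; rewrite inE/= in_itv/= andbT; exact: cF.
have gt0x x : a <= x -> 0 < 1 + x by move=> /(le_trans a0) x0; rewrite ltr_wpDr.
have i0 x : a <= x -> 0 <= integrand x.
  move=> ax; rewrite /integrand mulr_ge0// ?invr_ge0 ?sqr_ge0//.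
  rewrite mulr_ge0// ?mulr_ge0 ?expR_ge0//.
  by rewrite !addr_ge0// ?sqr_ge0// (le_trans a0).
have mg : measurable_fun setT (@half_gauss R).
  exact: continuous_measurable_fun.
have mi : measurable_fun `[a, +oo[ integrand.
  exact: subspace_continuous_measurable_fun.
apply: (@le_trans _ _ (\int[mu]_(x in `[a, +oo[) (integrand x)%:E)%E).
  apply: ge0_le_integral => //=.
  - by move=> x _; rewrite lee_fin expR_ge0.
  - exact/measurable_EFinP/measurable_funTS.
  - exact/measurable_EFinP.
  - move=> x; rewrite in_itv/= andbT => ax; rewrite lee_fin /integrand.
    rewrite ler_pdivlMr ?exprn_gt0 ?gt0x//.
    rewrite -subr_ge0.
    rewrite [X in 0 <= X](_ : _ = half_gauss x * (x ^+ 2 + 1)); last ring.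
    by rewrite mulr_ge0 ?expR_ge0 ?addr_ge0 ?sqr_ge0.
rewrite (@ge0_continuous_FTC2y _ _ primitive _ 0).
- by rewrite /primitive EFinN oppeK add0e.
- exact: i0.
- exact: wF.
- exact: cvg_primitive.
- by move=> x ax; have [] := dF x (ltW ax).
- apply: cvg_at_right_filter; apply: differentiable_continuous.
  by apply/derivable1_diffP; have [] := dF a (lexx a).
- move=> x; rewrite in_itv/= andbT => ax; rewrite derive1E.
  by have [_ ->] := dF x (ltW ax).
Qed.

(* The singularities of this function are at +-sqrt(1 + a^2), and its integral
   over [-a, a] stays bounded in a; this is what makes the step from one
   coordinate to two lose no logarithm. *)
Let arcsine_density a x : R := (Num.sqrt (1 + a ^+ 2 - x ^+ 2))^-1.

Let continuous_arcsine_density a :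
  {within `[- a, a], continuous (arcsine_density a)}.
Proof.
apply: continuous_in_subspaceT => x; rewrite inE/= in_itv/= => xa.
apply: cvgV.
  rewrite gt_eqF// sqrtr_gt0; move: xa => /andP[ax xa]; nra.
apply: (@cvg_comp _ _ _ (fun x => 1 + a ^+ 2 - x ^+ 2) Num.sqrt _
  (nbhs (1 + a ^+ 2 - x ^+ 2))); last exact: sqrt_continuous.
by apply: cvgB; [exact: cvg_cst|exact: exprn_continuous].
Qed.

Lemma integral_arcsine_le a : 0 < a ->
  (\int[mu]_(x in `[(- a)%R, a]) ((Num.sqrt (1 + a ^+ 2 - x ^+ 2))^-1)%:E <=
    pi%:E)%E.
Proof.
move=> a0; pose q := Num.sqrt (1 + a ^+ 2).
have q2 : q ^+ 2 = 1 + a ^+ 2 by rewrite sqr_sqrtr// addr_ge0 ?sqr_ge0.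
have q0 : 0 < q by rewrite sqrtr_gt0 ltr_pwDl// sqr_ge0.
have aq : a < q by rewrite -(ltr_pXn2r (ltn0Sn 1)) ?nnegrE ?ltW// q2 ltrDr.
have NaaP x : - a <= x <= a -> -1 < x / q < 1.
  move=> /andP[ax xa]; rewrite ltr_pdivlMr// ltr_pdivrMr//.
  by apply/andP; split; lra.
have dF x : - a <= x <= a ->
    is_derive x 1 (fun y => asin (y / q)) (Num.sqrt (1 + a ^+ 2 - x ^+ 2))^-1.
  move=> /NaaP xq.
  have dq : is_derive x 1 (fun y : R => y / q) q^-1.
    by apply: is_derive_eq; rewrite /GRing.scale /=; ring.
  have := @is_derive1_comp _ asin (fun y => y / q) x _ _
    (is_derive1_asin xq) dq.
  move=> /is_derive_eq; apply.
  rewrite -invfM; congr (_^-1); rewrite -{2}(gtr0_norm q0) -sqrtr_sqr -sqrtrM.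
    by congr Num.sqrt; rewrite mulrBl mul1r -exprMn divfK ?gt_eqF// q2.
  rewrite subr_ge0 -real_normK ?num_real// expr_le1//.
  by rewrite ler_norml; move: xq => /andP[/ltW-> /ltW->].
rewrite (@continuous_FTC2 _ _ (fun y => asin (y / q))).
- rewrite -EFinB lee_fin.
  have /andP[l1 u1] : -1 < a / q < 1 by apply: NaaP; lra.
  have /andP[l2 u2] : -1 < - a / q < 1 by apply: NaaP; lra.
  have : asin (a / q) <= pi / 2 by rewrite asin_lepi2 ?(ltW l1) ?ltW.
  have : - (pi / 2) <= asin (- a / q) by rewrite asin_geNpi2 ?(ltW l2) ?ltW.
  lra.
- lra.
- exact: continuous_arcsine_density.
- have cF x : - a <= x <= a -> {for x, continuous (fun y : R => asin (y / q))}.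
    by move=> /dF[dx _]; apply/differentiable_continuous/derivable1_diffP.
  split.
  + move=> x; rewrite in_itv/= => /andP[/ltW ax /ltW xa].
    by have [] := dF x; rewrite ?ax.
  + by apply: cvg_at_right_filter; apply: cF; lra.
  + by apply: cvg_at_left_filter; apply: cF; lra.
- move=> x; rewrite in_itv/= derive1E => /andP[/ltW ax /ltW xa].
  by have [|_ ->] := dF x; rewrite ?ax.
Qed.

(** The two regimes of the integral over one coordinate x.  For |x| >= a the
    other coordinates are unconstrained and a Gaussian tail is left; for
    |x| <= a they still have to lie outside a ball. *)
Lemma integral_line_le (f : R -> R) a c m :
  0 <= a -> 0 <= c -> 0 <= m -> measurable_fun setT f -> (forall x, 0 <= f x) ->
  (forall x, a <= `|x| -> f x <= c * half_gauss x) ->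
  (forall x, 0 < a -> `|x| <= a -> f x <= m / Num.sqrt (1 + a ^+ 2 - x ^+ 2)) ->
  (\int[mu]_x (f x)%:E <= (m * pi + 4 * c * half_gauss a / (1 + a))%:E)%E.
Proof.
move=> a0 c0 m0 mf f0 ftail fmid.
have half_gaussN x : half_gauss (- x) = half_gauss x.
  by rewrite /half_gauss sqrrN.
have mg : measurable_fun setT (@half_gauss R).
  exact: continuous_measurable_fun.
have right : (\int[mu]_(x in `[a, +oo[) (f x)%:E <=
    (c * (2 * half_gauss a / (1 + a)))%:E)%E.
  apply: (@le_trans _ _
      (\int[mu]_(x in `[a, +oo[) (c%:E * (half_gauss x)%:E))%E).
    apply: ge0_le_integral => //=.
    - by move=> x _; rewrite lee_fin.
    - exact/measurable_EFinP/measurable_funTS.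
    - by apply: measurable_funeM; exact/measurable_EFinP/measurable_funTS.
    - move=> x; rewrite in_itv/= andbT => ax; rewrite lee_fin ftail//.
      exact: le_trans ax (ler_norm x).
  rewrite ge0_integralZl//; last 2 first.
    + exact/measurable_EFinP/measurable_funTS.
    + by move=> x _; rewrite lee_fin expR_ge0.
  by rewrite EFinM lee_wpmul2l ?lee_fin// integral_gauss_tail_le.
have left : (\int[mu]_(x in `]-oo, (- a)%R]) (f x)%:E <=
    (c * (2 * half_gauss a / (1 + a)))%:E)%E.
  apply: (@le_trans _ _
      (\int[mu]_(x in `]-oo, (- a)%R]) (c%:E * (half_gauss x)%:E))%E).
    apply: ge0_le_integral => //=.
    - by move=> x _; rewrite lee_fin.
    - exact/measurable_EFinP/measurable_funTS.
    - by apply: measurable_funeM; exact/measurable_EFinP/measurable_funTS.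
    - move=> x; rewrite in_itv/= => xa; rewrite lee_fin ftail//.
      by rewrite -normrN (le_trans _ (ler_norm (- x)))// lerNr.
  rewrite ge0_integralZl//; last 2 first.
    + exact/measurable_EFinP/measurable_funTS.
    + by move=> x _; rewrite lee_fin expR_ge0.
  rewrite EFinM lee_wpmul2l ?lee_fin//.
  rewrite ge0_integration_by_substitutionNy; last 2 first.
    + exact: continuous_subspaceT.
    + by move=> x _; exact: expR_ge0.
  under eq_integral => x _ do rewrite /= half_gaussN.
  exact: integral_gauss_tail_le.
have mid : (\int[mu]_(x in `[(- a)%R, a]) (f x)%:E <= (m * pi)%:E)%E.
  move: a0; rewrite le_eqVlt => /predU1P[<-|a0].
    by rewrite oppr0 set_itv1 integral_set1 lee_fin mulr_ge0// pi_ge0.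
  have mw : measurable_fun `[- a, a] (arcsine_density a).
    by apply: subspace_continuous_measurable_fun => //;
      exact: continuous_arcsine_density.
  apply: (@le_trans _ _ (\int[mu]_(x in `[(- a)%R, a])
      (m%:E * ((Num.sqrt (1 + a ^+ 2 - x ^+ 2))^-1)%:E))%E).
    apply: ge0_le_integral => //=.
    - by move=> x _; rewrite lee_fin.
    - exact/measurable_EFinP/measurable_funTS.
    - by apply: measurable_funeM; apply/measurable_EFinP; exact: mw.
    - move=> x; rewrite in_itv/= => xa; rewrite lee_fin fmid// ler_norml//.
  rewrite ge0_integralZl//; last first.
    by apply/measurable_EFinP; exact: mw.
  by rewrite EFinM lee_wpmul2l ?lee_fin// integral_arcsine_le.
have mfE (D : set R) : measurable_fun D (EFin \o f).
  exact/measurable_EFinP/measurable_funTS.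
have Na : - a <= a by lra.
rewrite -(setUv `]-oo, (- a)[) ge0_integral_setU//=; last 4 first.
  - exact: measurableC.
  - exact: mfE.
  - by move=> x _; rewrite lee_fin.
  - exact/disj_setPCl.
rewrite setCitvl (@itv_bndbnd_setU _ _ (BLeft (- a)) (BRight a) +oo%O)//.
rewrite ge0_integral_setU//=; last 3 first.
  - exact: mfE.
  - by move=> x _; rewrite lee_fin.
  - apply/disj_setPS => x [/=].
    by rewrite !in_itv/= andbT => /andP[_ xa] /lt_geF; rewrite xa.
rewrite integral_itv_bndo_bndc// integral_itv_obnd_cbnd//.
have := leeD left (leeD mid right).
move/le_trans; apply; rewrite -!EFinD lee_fin.
rewrite le_eqVlt; apply/orP; left; apply/eqP.
by field; rewrite gt_eqF// ltr_pwDl.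
Qed.

End one_coordinate.

(** * Integrating radial functions one coordinate at a time *)

Section radial.
Context {R : realType}.
Implicit Types (t u x : R) (j d : nat).

(* With u the square norm of the coordinates still to be integrated, gap t u is
   how much square norm the others must contribute to exceed t. *)
Let gap t u : R := Num.max 0 (t - u).
Let width t u : R := Num.sqrt (1 + gap t u).

(** For j > 0 and up to the constant, this is
    exp(-max(t,u)/2) (1 + (t-u)^+)^((j-2)/2), which is the order of the integral of exp(-(u+|y|^2)/2) over the y in R^j with
    u + |y|^2 > t.  The half-integral exponent is split as (j-1)/2 - 1/2, so
    that it is meaningful for j = 1 without real powers. *)
Definition radial_bound t j u : R :=
  if j is i.+1 then
    (4 + pi) ^+ j * expR (- ((u + gap t u) / 2)) * width t u ^+ i / width t u
  else if t < u then expR (- (u / 2)) else 0.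

Let gap_ge0 t u : 0 <= gap t u. Proof. by rewrite /gap le_max lexx. Qed.

Let width2 t u : width t u ^+ 2 = 1 + gap t u.
Proof. by rewrite sqr_sqrtr// addr_ge0. Qed.

Let width_ge1 t u : 1 <= width t u.
Proof. by rewrite -sqrtr1 ler_wsqrtr// lerDl. Qed.

Let width_gt0 t u : 0 < width t u.
Proof. exact: lt_le_trans (width_ge1 t u). Qed.

Let const_gt0 : 0 < 4 + pi :> R.
Proof. by rewrite addr_gt0// pi_gt0. Qed.

Lemma radial_bound_ge0 t j u : 0 <= radial_bound t j u.
Proof.
case: j => [|j] /=; first by case: ifP; rewrite ?expR_ge0.
by rewrite divr_ge0 ?mulr_ge0 ?expR_ge0 ?exprn_ge0 ?sqrtr_ge0 ?(ltW const_gt0).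
Qed.

Lemma measurable_radial_bound t j : measurable_fun setT (radial_bound t j).
Proof.
case: j => [|j].
  apply: measurable_fun_ifT => //; first exact: measurable_fun_ltr.
  apply: measurableT_comp => //; apply: measurableT_comp => //.
  exact: measurable_funM.
have cgap : continuous (gap t).
  move=> u; apply: (@continuous_max _ _ (fun=> 0) (fun u => t - u)).
    exact: cvg_cst.
  by apply: cvgB; [exact: cvg_cst|exact: cvg_id].
have cw : continuous (width t).
  move=> u; apply: (@cvg_comp _ _ _ (fun u => 1 + gap t u) Num.sqrt _
    (nbhs (1 + gap t u))); last exact: sqrt_continuous.
  by apply: cvgD; [exact: cvg_cst|exact: cgap].
apply: continuous_measurable_fun => u.
apply: cvgM; last by apply: cvgV; [rewrite gt_eqF|exact: cw].
apply: cvgM; last first.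
  apply: (@cvg_comp _ _ _ (width t) (fun y => y ^+ j) _ (nbhs (width t u))).
    exact: cw.
  exact: exprn_continuous.
apply: cvgM; first exact: cvg_cst.
apply: continuous_comp; last exact: continuous_expR.
apply: cvgN; apply: cvgM; last exact: cvg_cst.
by apply: cvgD; [exact: cvg_id|exact: cgap].
Qed.

(** For |x| <= sqrt(gap t u) the exponential factor does not depend on x, the
    power width^(j-1) only decreases, and the remaining factor 1/width is the
    arcsine density.  Beyond, width is 1 and a Gaussian tail is left. *)
Lemma integral_radial_bound_le t j u :
  (\int[@lebesgue_measure R]_x (radial_bound t j (u + x ^+ 2))%:E
    <= (radial_bound t j.+1 u)%:E)%E.
Proof.
pose a := Num.sqrt (gap t u).
have a0 : 0 <= a by exact: sqrtr_ge0.
have a2 : a ^+ 2 = gap t u by rewrite sqr_sqrtr.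
pose e := expR (- ((u + gap t u) / 2)).
have e0 : 0 < e by exact: expR_gt0.
have mf : measurable_fun setT (fun x => radial_bound t j (u + x ^+ 2)).
  apply: (measurableT_comp (measurable_radial_bound t j)).
  exact: measurable_funD.
have in_a x : `|x| <= a -> x ^+ 2 <= gap t u.
  by move=> xa; rewrite -a2 -real_normK ?num_real// lerXn2r ?nnegrE.
have gapE : 0 < a -> gap t u = t - u.
  rewrite sqrtr_gt0 /gap; case: (lerP 0 (t - u)) => //; lra.
have gap_in x : 0 < a -> `|x| <= a -> gap t (u + x ^+ 2) = gap t u - x ^+ 2.
  move=> ap /in_a; rewrite gapE// /gap => xa.
  by rewrite max_r; lra.
have gap_out x : a <= `|x| -> t <= u + x ^+ 2.
  move=> ax; have : gap t u <= x ^+ 2.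
    by rewrite -a2 -[leRHS]real_normK ?num_real// lerXn2r ?nnegrE.
  have : t - u <= gap t u by rewrite /gap le_max lexx orbT.
  lra.
have eE : expR (- (u / 2)) * half_gauss a = e.
  by rewrite -expRD a2; congr expR; lra.
have wa : (1 + a)^-1 <= (width t u)^-1.
  rewrite lef_pV2 ?posrE ?ltr_pwDl// -(ler_pXn2r (ltn0Sn 1)) ?nnegrE
    ?sqrtr_ge0 ?addr_ge0//.
  by rewrite width2 -a2; nra.
have w1 i : 1 <= width t u ^+ i by rewrite exprn_ege1.
case: j mf => [|j] mf.
  (* Below sqrt(gap t u) the indicator vanishes: the middle constant is 0. *)
  apply: le_trans
    (integral_line_le a0 (expR_ge0 (- (u / 2))) (lexx 0) mf _ _ _) _.
  - by move=> x; exact: radial_bound_ge0.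
  - move=> x _ /=; case: ifP => _; last by rewrite mulr_ge0// expR_ge0.
    by rewrite -expRD le_eqVlt; apply/orP; left; apply/eqP; congr expR; lra.
  - move=> x ap xa /=; rewrite mul0r.
    rewrite ifF//; apply/negbTE; rewrite -leNgt.
    by have := in_a x xa; rewrite gapE//; lra.
  rewrite lee_fin mul0r add0r -mulrA -mulrA [_ * (half_gauss a / _)]mulrA eE /=.
  rewrite -/e expr1 expr0 mulr1 mulrA.
  apply: ler_pM => //; rewrite ?mulr_ge0 ?invr_ge0 ?addr_ge0 ?(ltW e0)//.
  by rewrite ler_wpM2r ?(ltW e0)// lerDl pi_ge0.
apply: le_trans (@integral_line_le _ _ a ((4 + pi) ^+ j.+1 * expR (- (u / 2)))
  ((4 + pi) ^+ j.+1 * e * width t u ^+ j) a0 _ _ mf _ _ _) _.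
- by rewrite mulr_ge0 ?expR_ge0 ?exprn_ge0 ?(ltW const_gt0).
- by rewrite !mulr_ge0 ?(ltW e0) ?exprn_ge0 ?sqrtr_ge0 ?(ltW const_gt0).
- by move=> x; exact: radial_bound_ge0.
- move=> x ax; rewrite /radial_bound.
  have g0 : gap t (u + x ^+ 2) = 0.
    by rewrite /gap max_l//; have := gap_out x ax; lra.
  rewrite /width g0 !addr0 sqrtr1 expr1n divr1 mulr1 -mulrA -expRD.
  by rewrite le_eqVlt; apply/orP; left; apply/eqP; congr (_ * expR _); lra.
- move=> x ap xa; rewrite /radial_bound gap_in//.
  rewrite (_ : u + x ^+ 2 + _ = u + gap t u); last by ring.
  rewrite -/e /width gap_in// a2 [1 + (_ - _)]addrA.
  rewrite ler_wpM2r ?invr_ge0 ?sqrtr_ge0// ler_wpM2l//.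
    by rewrite mulr_ge0 ?(ltW e0)// exprn_ge0// ltW.
  rewrite lerXn2r ?nnegrE ?sqrtr_ge0// ler_wsqrtr//.
  by rewrite gerDl oppr_le0 sqr_ge0.
rewrite lee_fin /radial_bound -/e.
rewrite [_ ^+ j.+2]exprS.
set K := (4 + pi) ^+ j.+1.
have K0 : 0 <= K by rewrite exprn_ge0// ltW.
rewrite (_ : 4 * _ * _ / _ = K * e * 4 * (1 + a)^-1); last by rewrite -eE; ring.
rewrite (_ : (4 + pi) * K * e * _ / _ =
    K * e * width t u ^+ j * pi + K * e * 4 * width t u ^+ j); last first.
  by rewrite exprS; field; rewrite gt_eqF.
rewrite lerD2l ler_wpM2l ?mulr_ge0 ?(ltW e0)//.
apply: le_trans (w1 j); rewrite invf_le1 ?ltr_pwDl//.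
by rewrite lerDl.
Qed.

End radial.

(** * Lebesgue measure on R^d and the Gaussian tail *)

Section sigma_finite_hypothesis.
Context d (T : measurableType d) (R : realType).
Variable mu : {measure set T -> \bar R}.
Hypothesis mu_sigma_finite : sigma_finite setT mu.

(** A copy of mu whose type carries the proof of sigma-finiteness, so that
    Tonelli's theorem for sigma-finite measures applies to it. *)
Definition with_sigma_finite of sigma_finite setT mu := mu : set T -> \bar R.

Local Notation nu := (with_sigma_finite mu_sigma_finite).

HB.instance Definition _ := Measure.copy nu mu.
HB.instance Definition _ :=
  Measure_isSigmaFinite.Build _ _ _ nu mu_sigma_finite.

Lemma fubini_tonelli_sigma_finite d' (T' : measurableType d')
    (m : {sigma_finite_measure set T' -> \bar R}) (f : T * T' -> \bar R) :
  measurable_fun setT f -> (forall z, 0 <= f z)%E ->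
  (\int[mu \x m]_z f z = \int[mu]_x \int[m]_y f (x, y))%E.
Proof. exact: (@fubini_tonelli1 _ _ _ _ _ nu m). Qed.

End sigma_finite_hypothesis.

Section lebesgue_measure_Rd.
Context {R : realType}.

Lemma lebesgue_Rd_succE n :
  lebesgue_Rd n.+1 = pushforward (lebesgue_Rd n \x (@lebesgue_measure R))%E
    (@cons_point R n) :> (set _ -> _).
Proof. by []. Qed.

Let cube n (k : R) : set (Rd R n) := [set v | forall i, `|tnth v i : R| <= k].
Arguments cube : clear implicits.

Let measurable_cube n k : measurable (cube n k).
Proof.
have -> : cube n k =
    \big[setI/setT]_(i < n) ((fun v => tnth v i : R) @^-1` `[- k, k]).
  apply/seteqP; split => v.
    move=> vk; rewrite -bigcap_seq => i _ /=.
    by rewrite in_itv/= -ler_norml; exact: vk.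
  rewrite -bigcap_seq => vk i; rewrite ler_norml.
  by have := vk i (mem_index_enum i); rewrite /= in_itv.
apply: bigsetI_measurable => i _; rewrite -[X in measurable X]setTI.
exact: measurable_tnth.
Qed.

Let lebesgue_Rd_cube_lty n k : (lebesgue_Rd n (cube n k) < +oo)%E.
Proof.
elim: n => [|n IHn].
  by rewrite /= diracE; case: (_ \in _); rewrite ltry.
rewrite lebesgue_Rd_succE /pushforward.
have -> : @cons_point R n @^-1` cube n.+1 k = cube n k `*` `[- k, k].
  apply/seteqP; split => -[v x].
    move=> vk; split => [i|] /=.
      by have := vk (lift ord0 i); rewrite tnthS.
    by rewrite in_itv/= -ler_norml; have := vk ord0; rewrite tnth0.
  move=> [/= vk]; rewrite in_itv/= -ler_norml => xk i.
  by case: (unliftP ord0 i) => [i' ->|->]; rewrite ?tnthS ?tnth0.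
rewrite product_measure1E//; last exact: measurable_cube.
rewrite lte_mul_pinfty// ?ge0_fin_numE//.
have := @lebesgue_measure_itv R `[- k, k]; rewrite /= => ->.
by case: ifP => _; rewrite ltry.
Qed.

Lemma sigma_finite_lebesgue_Rd n : sigma_finite setT (@lebesgue_Rd R n).
Proof.
exists (fun k => cube n k%:R); last first.
  by move=> k; split; [exact: measurable_cube|exact: lebesgue_Rd_cube_lty].
apply/esym/seteqP; split => // v _.
have [k vk] : exists k : nat, \sum_(i < n) `|tnth v i : R| <= k%:R.
  exists (Num.bound (\sum_(i < n) `|tnth v i : R|)).
  exact/ltW/archi_boundP/sumr_ge0.
exists k => // i; apply: le_trans vk.
by rewrite (bigD1 i)//= lerDl sumr_ge0.
Qed.

Lemma integral_lebesgue_Rd_succ n (f : Rd R n.+1 -> \bar R) :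
  measurable_fun setT f -> (forall v, 0 <= f v)%E ->
  (\int[lebesgue_Rd n.+1]_v f v =
   \int[lebesgue_Rd n]_v \int[@lebesgue_measure R]_x f (cons_point (v, x)))%E.
Proof.
move=> mf f0.
rewrite [LHS](ge0_integral_pushforward (@measurable_cons_point R n))//.
rewrite preimage_setT fubini_tonelli_sigma_finite//.
- exact: sigma_finite_lebesgue_Rd.
- exact: measurableT_comp (@measurable_cons_point R n).
- by move=> z; exact: f0.
Qed.

Definition sumsq n (v : Rd R n) : R := \sum_(i < n) (tnth v i : R) ^+ 2.

Lemma measurable_sumsq n : measurable_fun setT (@sumsq n).
Proof.
apply: measurable_sum => i; apply: measurable_funX; exact: measurable_tnth.
Qed.

Lemma sumsq_cons_point n (v : Rd R n) (x : R) :
  sumsq (cons_point (v, x)) = sumsq v + x ^+ 2.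
Proof.
rewrite /sumsq big_ord_recl tnth0 addrC; congr +%R.
by apply: eq_bigr => i _; rewrite tnthS.
Qed.

(** The last coordinate is integrated first, which raises j by one; the offset
    u carries the square norm of the coordinates outside the integral. *)
Lemma integral_sumsq_radial_bound_le (d j : nat) (t u : R) :
  (\int[lebesgue_Rd d]_v (radial_bound t j (u + sumsq v))%:E
    <= (radial_bound t (j + d) u)%:E)%E.
Proof.
have mr n i : measurable_fun setT
    (fun v : Rd R n => (radial_bound t i (u + sumsq v))%:E).
  apply/measurable_EFinP.
  apply: (measurableT_comp (measurable_radial_bound t i)).
  by apply: measurable_funD => //; exact: measurable_sumsq.
elim: d j => [|n IHn] j.
  rewrite [leLHS](integral_dirac eorigin)//; last exact: mr.
  by rewrite diracT mul1e /sumsq big_ord0 addr0 addn0.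
rewrite integral_lebesgue_Rd_succ//; last first.
  by move=> v; rewrite lee_fin radial_bound_ge0.
apply: (@le_trans _ _
    (\int[lebesgue_Rd n]_v (radial_bound t j.+1 (u + sumsq v))%:E)%E).
  apply: ge0_le_integral_setT => v.
    by apply: integral_ge0 => x _; rewrite lee_fin radial_bound_ge0.
  under eq_integral => x _ do rewrite sumsq_cons_point addrA.
  exact: integral_radial_bound_le.
by rewrite addnS -addSn.
Qed.

End lebesgue_measure_Rd.

Section gaussian_tail.
Context {R : realType}.

Lemma sumsqE d (x : Rd R d) : sumsq x = enorm x ^+ 2.
Proof. by rewrite sqr_sqrtr// sumr_ge0// => i _; rewrite sqr_ge0. Qed.

Lemma enorm_esub0 d (x : Rd R d) : enorm (esub x eorigin) = enorm x.
Proof.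
rewrite /enorm; congr Num.sqrt; apply: eq_bigr => i _.
by rewrite !tnth_mktuple subr0.
Qed.

Lemma measurable_outside_eball d (r : R) :
  measurable (~` closed_eball r eorigin : set (Rd R d)).
Proof.
apply: measurableC.
have -> : closed_eball r eorigin = (@enorm R d) @^-1` `]-oo, r].
  by apply/seteqP; split => x /=; rewrite /closed_eball/= enorm_esub0 in_itv.
rewrite -[X in measurable X]setTI.
exact: (measurableT_comp
  (@continuous_measurable_fun _ _ (@sqrt_continuous R))
  (@measurable_sumsq R d)).
Qed.

Lemma c_gauss_ge0 d : 0 <= @c_gauss R d.
Proof.
by rewrite invr_ge0 fine_ge0// integral_ge0// => x _; rewrite lee_fin expR_ge0.
Qed.

Lemma gauss_tail_le d (r : R) : 0 <= r ->
  (\int[lebesgue_Rd d]_(x in ~` closed_eball r eorigin) (gauss_density x)%:E <=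
    (@c_gauss R d * radial_bound (r ^+ 2) d 0)%:E)%E.
Proof.
move=> r0.
have mc := @measurable_outside_eball d r.
have mD : measurable_fun setT
    (fun x : Rd R d => (radial_bound (r ^+ 2) 0 (0 + sumsq x))%:E).
  apply/measurable_EFinP.
  apply: (measurableT_comp (measurable_radial_bound _ _)).
  by apply: measurable_funD => //; exact: measurable_sumsq.
apply: (@le_trans _ _ (\int[lebesgue_Rd d]_x
    ((@c_gauss R d)%:E * (radial_bound (r ^+ 2) 0 (0 + sumsq x))%:E))%E).
  rewrite integral_mkcond; apply: ge0_le_integral_setT => x; rewrite patchE.
    by case: ifP => _ //; rewrite lee_fin mulr_ge0 ?c_gauss_ge0 ?expR_ge0.
  case: ifPn => [|_]; last first.
    by rewrite -EFinM lee_fin mulr_ge0 ?c_gauss_ge0 ?radial_bound_ge0.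
  rewrite inE /= /closed_eball /= enorm_esub0 => /negP; rewrite -ltNge => rx.
  rewrite -EFinM lee_fin /gauss_density /gauss_exp add0r sumsqE.
  by rewrite /radial_bound ltrXn2r ?nnegrE ?sqrtr_ge0// rx.
rewrite ge0_integralZl//; last 2 first.
  - by move=> x _; rewrite lee_fin radial_bound_ge0.
  - by rewrite lee_fin c_gauss_ge0.
rewrite EFinM lee_wpmul2l ?lee_fin ?c_gauss_ge0//.
exact: (integral_sumsq_radial_bound_le d 0).
Qed.

End gaussian_tail.

(** * The outlier radius *)

Section asymptotics.
Context {R : realType}.

(** With L = ln n and d = i + 1, the product n exp(-R_n^2/2) is
    L^(-(d-2+eps)/2), and the power of 1 + R_n^2 in the tail bound is of order
    L^((d-2)/2).  Only L^(-eps/2) is left. *)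
Lemma natr_radial_bound_le (i n : nat) (eps : R) :
  0 < eps -> 1 <= ln n%:R :> R ->
  n%:R * radial_bound (outlier_radius i.+1 eps n ^+ 2) i.+1 0 <=
  (4 + pi) ^+ i.+1 * Num.sqrt (i%:R + 4 + eps) ^+ i *
    expR (- (eps / 2 * ln (ln n%:R))).
Proof.
move=> eps0; set L := ln n%:R => L1.
have n0 : (0 < n)%N by case: n @L L1 => //= ; rewrite ln0// ler10.
have nE : n%:R = expR L :> R by rewrite lnK// posrE ltr0n.
have L0 : 0 < L by exact: lt_le_trans L1.
pose l := ln L.
have LE : L = expR l by rewrite lnK.
have l0 : 0 <= l by rewrite ln_ge0.
have lL : l <= L by rewrite [leRHS]LE (le_trans _ (expR_ge1Dx l))// lerDr.
have i0 : 0 <= i%:R :> R by [].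
pose t := 2 * L + (i.+1%:R - 2 + eps) * l.
have tE : t = 2 * L + (i%:R - 1 + eps) * l.
  by rewrite /t -natr1; congr (_ + _ * _); ring.
(* 1 + t lies between L and a constant multiple of L: the first bound serves
   the factor 1 / sqrt(1 + t), the second the i-th power. *)
have Lt : L <= t by rewrite tE; nra.
have tL : 1 + t <= (i%:R + 4 + eps) * L by rewrite tE; nra.
have rE : outlier_radius i.+1 eps n ^+ 2 = t.
  by rewrite sqr_sqrtr// -/L -/l (le_trans _ Lt)// ltW.
rewrite rE /radial_bound subr0 add0r max_r ?(le_trans _ Lt) ?(ltW L0)//.
have D0 : 0 <= i%:R + 4 + eps by rewrite !addr_ge0// ltW.
have sL : Num.sqrt L = expR (l / 2).
  rewrite LE -[X in Num.sqrt X](_ : expR (l / 2) ^+ 2 = _) ?sqrtr_sqr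
    ?ger0_norm ?expR_ge0// -expRM_natl.
  by congr expR; lra.
have w_le : Num.sqrt (1 + t) <= Num.sqrt (i%:R + 4 + eps) * expR (l / 2).
  by rewrite -sL -sqrtrM// ler_wsqrtr.
have w_ge : expR (l / 2) <= Num.sqrt (1 + t).
  by rewrite -sL ler_wsqrtr// (le_trans Lt)// lerDr.
have K0 : 0 <= (4 + pi : R) by rewrite addr_ge0// pi_ge0.
set K := (4 + pi) ^+ i.+1.
have KK : 0 <= K by rewrite exprn_ge0.
rewrite nE (_ : expR L * _ = K *
    (expR (L - t / 2) * (Num.sqrt (1 + t) ^+ i / Num.sqrt (1 + t)))); last first.
  by rewrite expRD; ring.
rewrite -mulrA ler_wpM2l//.
apply: (@le_trans _ _ (expR (L - t / 2) *
    ((Num.sqrt (i%:R + 4 + eps) * expR (l / 2)) ^+ i / expR (l / 2)))).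
  rewrite ler_wpM2l ?expR_ge0// ler_pM ?exprn_ge0 ?invr_ge0 ?sqrtr_ge0//.
    by rewrite lerXn2r ?nnegrE ?mulr_ge0 ?sqrtr_ge0 ?expR_ge0.
  by rewrite lef_pV2 ?posrE ?expR_gt0// (lt_le_trans (expR_gt0 _) w_ge).
rewrite exprMn mulrCA -2!mulrA ler_wpM2l ?exprn_ge0 ?sqrtr_ge0//.
rewrite -expRM_natl -expRN -!expRD ler_expR tE -/l.
lra.
Qed.

Lemma cvg_iterated_ln_decay (C eps : R) : 0 < eps ->
  C * expR (- (eps / 2 * ln (ln n%:R))) @[n --> \oo] --> (0 : R).
Proof.
move=> eps0.
have lny : ln x @[x --> +oo] --> (+oo : set_system R).
  apply/cvgryPge => y; near=> x; rewrite -ler_expR lnK ?posrE; near: x.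
    exact: nbhs_pinfty_ge.
  exact: nbhs_pinfty_gt.
rewrite -(mulr0 C); apply: cvgM; first exact: cvg_cst.
have decay : expR (- (eps / 2 * y)) @[y --> +oo] --> (0 : R).
  apply: (@cvg_comp _ _ _ (fun y : R => eps / 2 * y) (fun y : R => expR (- y)) _
    (pinfty_nbhs R)); last exact: cvgr_expR.
  by apply: (@gt0_cvgMry _ _ _ _ id); [rewrite divr_gt0|exact: cvg_id].
exact: (cvg_comp _ _ (cvg_comp _ _ (cvg_comp _ _ cvgr_idn lny) lny) decay).
Unshelve. all: by end_near. Qed.

End asymptotics.

Theorem theorem2p6 (R : realType) (d : nat) (dO : measure_display)
    (Omega : measurableType dO) (P : probability Omega R)
    (X : nat -> {RV P >-> Rd R d}) (eps : R) (k : nat) :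
  (1 <= d)%N -> 0 < eps ->
  mutually_independent X ->
  (forall i, has_density (X i) gauss_density) ->
  (k <= d.-1)%N ->
  (fun n : nat => ('E_P[fun w : Omega =>
     (betti k (cech (outside_ball (sample (fun i => X i w) n)
                       (outlier_radius d eps n)) 1))%:R])%E)
    @ \oo --> 0%E.
Proof.
case: d X => // i X _ eps0 indep dens _.
pose A n : set (Rd R i.+1) :=
  ~` closed_eball (outlier_radius i.+1 eps n) eorigin.
have mA n : measurable (A n) by exact: measurable_outside_eball.
pose p n : R := fine (P (X 0%N @^-1` A n)).
have PA n j : P (X j @^-1` A n) = (p n)%:E.
  rewrite fineK; last first.
    apply: fin_num_measure; rewrite -[X in measurable X]setTI.
    exact: measurable_funP.
  exact: etrans (dens j _ (mA n)) (esym (dens 0%N _ (mA n))).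
have p0 n : 0 <= p n by rewrite fine_ge0.
pose C : R := @c_gauss R i.+1 *
  ((4 + pi) ^+ i.+1 * Num.sqrt (i%:R + 4 + eps) ^+ i).
have C0 : 0 <= C.
  apply: mulr_ge0; first exact: c_gauss_ge0.
  apply: mulr_ge0; apply: exprn_ge0; last exact: sqrtr_ge0.
  by rewrite addr_ge0// pi_ge0.
have ln_ge1 : \forall n \near \oo, 1 <= ln n%:R :> R.
  near=> n; have en : expR 1 <= n%:R :> R by near: n; exact: nbhs_infty_ger.
  by rewrite -ler_expR lnK ?posrE ?(lt_le_trans (expR_gt0 1) en).
pose b n : R := C * expR (- (eps / 2 * ln (ln n%:R))).
apply: (@squeeze_cvge _ _ _ _ (fun=> 0%E) _ (fun n => (b n ^+ k.+1)%:E)).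
- near=> n; apply/andP; split.
    by apply: expectation_ge0 => w; rewrite ler0n.
  apply: le_trans (expectation_betti_outside_le k n indep (mA n) (PA n)) _.
  rewrite lee_fin lerXn2r ?nnegrE ?(mulr_ge0 C0) ?expR_ge0 ?mulr_ge0//.
  have pn : p n <= @c_gauss R i.+1 *
      radial_bound (outlier_radius i.+1 eps n ^+ 2) i.+1 0.
    rewrite -lee_fin -(PA n 0%N).
    apply: le_trans (gauss_tail_le _ _); last exact: sqrtr_ge0.
    by rewrite le_eqVlt; apply/orP; left; apply/eqP; exact: dens.
  apply: (le_trans (ler_wpM2l (ler0n _ n) pn)).
  rewrite mulrCA /b /C -mulrA ler_wpM2l ?c_gauss_ge0// natr_radial_bound_le//.
  by near: n.
- exact: cvg_cst.
- apply: cvg_EFin; first by near=> n.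
  have b0 : b n @[n --> \oo] --> (0 : R) by exact: cvg_iterated_ln_decay.
  rewrite -[X in _ --> X](expr0n R k.+1).
  exact: (cvg_comp b (fun y => y ^+ k.+1) b0 (@exprn_continuous R k.+1 0)).
Unshelve. all: by end_near. Qed.
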